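(* Let $\Gamma_c$ be the underlying combinatorial graph of a quantum graph, with $n$ vertices and $m$ edges, and let $\delta_t^*,\delta_s^*,\tau,\mathcal S$ be the matrices defined in the context. The bond-scattering matrix can be written as $$\mathcal{S} = 2\,\delta_s \mathcal{D}^{-1}\delta^*_t - \tau ,$$ where $\mathcal{D} = \delta^*_s \delta_s = \delta^*_t \delta_t$ is the diagonal matrix of the degrees $d_v$ of the vertices. Some additional matrix factorizations are the following (matrix: formula; dimensions; notes). 1. Incidence matrix: $\delta_t^*-\delta_s^*$; $n\times 2m$; oriented. 2. Adjacency matrix: $\mathcal A=\delta_t^*\delta_s$; $n\times n$. 3. Degree matrix: $\mathcal D=\delta_t^*\delta_t=\delta_s^*\delta_s$; $n\times n$; equal to $\operatorname{diag}(d_v)$. 4. Discrete Laplacian: $\mathcal L=\mathcal D-\mathcal A=\delta_t^*(\delta_t-\delta_s)=(\delta_s^*-\delta_t^* )\delta_s$; $n\times n$; $\mathcal L\ge 0$. 5. Normalized Laplacian: $\mathcal D^{-1/2}(\delta_t^*-\delta_s^* )(\delta_t-\delta_s)\mathcal D^{-1/2}$; $n\times n$. 6. Laplacian on forms (= 1-down Laplacian): $(\delta_t-\delta_s)\mathcal D^{-1}(\delta_t^*-\delta_s^* )$; $2m\times 2m$; reduces to $m\times m$. 7. Edge reversal: $\tau=\begin{pmatrix}0&\mathbb 1\\ \mathbb 1&0\end{pmatrix}$; $2m\times 2m$ (or $4m\times 4m$). 8. Bond-scattering matrix: $\mathcal S=2\delta_s\mathcal D^{-1}\delta_t^*-\tau$;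 $2m\times 2m$; unitary. 9. Nonbacktracking matrix: $\mathcal H=\delta_t\delta_s^*$; $2m\times 2m$; self-loops are excluded. 10. Bond transfer matrix: $\Phi(k)=\mathrm{BMat}(\Phi_{\bf e}(k))$; $4m\times 4m$; edge solution matrices. 11. Secular matrix: $\mathbb 1_{4m}-(\mathcal S\otimes\mathbb 1_2)\Phi(k)$; $4m\times 4m$; edge version. Basic facts about the edge-reversal operator $\tau$ include: $\tau^2=\mathbb 1$; $\delta_t^*\tau=\delta_s^*$ and $\delta_s^*\tau=\delta_t^*$; $\tau\mathcal S\tau=\mathcal S^{-1}=\mathcal S^*$.
   Context: Each edge gives rise to two oriented edges, ${\bf e}$ and its reversal $-{\bf e}$, so there are $2m$ oriented edges. The oriented edge ${\bf e}$ has source vertex $s({\bf e})$ and terminal vertex $t({\bf e})$, with $s(-{\bf e})=t({\bf e})$ and $t(-{\bf e})=s({\bf e})$. The oriented edges are ordered so that the second $m$ of them are the reversals of the first $m$, in the same order. $\delta_t^*$ is the $n\times 2m$ matrix (rows: vertices, columns: oriented edges) with $(\delta_t^* )_{t({\bf e}),{\bf e}}=1$ and all other entries $0$. Correspondingly, $\delta_s^*$ is the $n\times 2m$ matrix with $(\delta_s^* )_{s({\bf e}),{\bf e}}=1$ and all other entries $0$. $\delta_t,\delta_s$ are their adjoints. $\tau$ is the edge-reversal operator ${\bf e}\mapsto-{\bf e}$. The bond-scattering matrix $\mathcal S$ is the $2m\times 2m$ matrix with $\mathcal S_{{\bf e}'{\bf e}}=0$ unless $t({\bf e})=s({\bf e}')$;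 if $t({\bf e})=s({\bf e}')$ and ${\bf e}'\neq-{\bf e}$, then $\mathcal S_{{\bf e}'{\bf e}}=\frac{2}{d_{t({\bf e})}}$; and $\mathcal S_{-{\bf e}\,{\bf e}}=\frac{2}{d_{t({\bf e})}}-1$. To each oriented edge ${\bf e}$ is attached an invertible $2\times 2$ transfer matrix $\Phi_{\bf e}(k)$, entire in $k$, thought of as the solution matrix of an equation $-\psi''+V\psi=k^2\psi$ on the edge: it maps (value, derivative) at $s({\bf e})$ to (value, derivative) at $t({\bf e})$. $\mathrm{BMat}(M_{\bf e})$ denotes the block-diagonal matrix with $2\times 2$ blocks $M_{{\bf e}_1},\dots,M_{{\bf e}_m},M_{-{\bf e}_1},\dots,M_{-{\bf e}_m}$.
   Formalization: Item 9: δ_tδ_s^* also has entry 1 at reversals e'=-e, so it is proved to be the full succession matrix, equal to the nonbacktracking matrix plus τ. Item 5: the displayed formula is kept and shown to be twice D^{-1/2}LD^{-1/2}. *)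

(* Defs.v *)
From HB Require Import structures.
From mathcomp Require Import all_boot all_order all_algebra.
From mathcomp Require Import spectral mxtens complex.
From mathcomp Require Import all_classical all_reals all_analysis.

Set Implicit Arguments.
Unset Strict Implicit.
Unset Printing Implicit Defensive.

Import Order.TTheory GRing.Theory Num.Theory.
Import numFieldNormedType.Exports.

Local Open Scope ring_scope.
Local Open Scope complex_scope.
Local Open Scope sesquilinear_scope.

(* A finite combinatorial graph with vertices 'I_n and edges 'I_m, each edge
   given with an arbitrary reference orientation.  Multiple edges and loops are
   allowed. *)
Record cgraph (n m : nat) := CGraph {
  etail : 'I_m -> 'I_n;
  ehead : 'I_m -> 'I_n
}.

Section OrientedEdges.
Variables n m : nat.
Implicit Types (G : cgraph n m) (e : 'I_(m + m)).

(* The oriented edges are 'I_(m + m): lshift m i is edge i with its reference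
   orientation and rshift m i is its reversal. *)
Definition src G e : 'I_n :=
  match fintype.split e with inl i => etail G i | inr i => ehead G i end.

Definition tgt G e : 'I_n :=
  match fintype.split e with inl i => ehead G i | inr i => etail G i end.

Definition rev e : 'I_(m + m) :=
  match fintype.split e with inl i => rshift m i | inr i => lshift m i end.

Lemma src_rev G e : src G (rev e) = tgt G e.
Proof.
by rewrite /src /tgt /rev; case: (fintype.split e) => i; rewrite (unsplitK (inl i), unsplitK (inr i)).
Qed.

Lemma tgt_rev G e : tgt G (rev e) = src G e.
Proof.
by rewrite /src /tgt /rev; case: (fintype.split e) => i; rewrite (unsplitK (inl i), unsplitK (inr i)).
Qed.

(* Loops count twice, both here and on the diagonal of the adjacency matrix. *)
Definition deg G (v : 'I_n) : nat :=
  (\sum_(i < m) ((etail G i == v) + (ehead G i == v)))%N.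

Definition adjnum G (v w : 'I_n) : nat :=
  (\sum_(i < m) (((etail G i == v) && (ehead G i == w)) +
                 ((etail G i == w) && (ehead G i == v))))%N.

End OrientedEdges.

Section GraphMatrices.
Variables (C : numClosedFieldType) (n m : nat) (G : cgraph n m).

Definition deltatS : 'M[C]_(n, m + m) := \matrix_(v, e) (v == tgt G e)%:R.
Definition deltasS : 'M[C]_(n, m + m) := \matrix_(v, e) (v == src G e)%:R.

Definition deltat : 'M[C]_(m + m, n) := deltatS^t*.
Definition deltas : 'M[C]_(m + m, n) := deltasS^t*.

Definition taumx : 'M[C]_(m + m) := \matrix_(e', e) (e' == rev e)%:R.

Definition degmx : 'M[C]_n := diag_mx (\row_v (deg G v)%:R).

(* The power -1/2 of degmx. *)
Definition degmx_isqrt : 'M[C]_n := diag_mx (\row_v (sqrtC (deg G v)%:R)^-1).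

Definition adjmx : 'M[C]_n := \matrix_(v, w) (adjnum G v w)%:R.

Definition lapmx : 'M[C]_n := degmx - adjmx.

Definition incmx : 'M[C]_(n, m + m) :=
  \matrix_(v, e) (if src G e == tgt G e then 0
                  else if v == tgt G e then 1
                  else if v == src G e then -1 else 0).

(* One column per unoriented edge, taken in its reference orientation. *)
Definition edge_incmx : 'M[C]_(n, m) := lsubmx incmx.

(* Since incmx has a column for each of the 2m oriented edges, each edge is
   counted twice here: this is 2 (1 - D^(-1/2) A D^(-1/2)). *)
Definition normlapmx : 'M[C]_n :=
  degmx_isqrt *m (incmx *m incmx^t*) *m degmx_isqrt.

Definition formlapmx : 'M[C]_(m + m) := incmx^t* *m invmx degmx *m incmx.

Definition edge_formlapmx : 'M[C]_m :=
  edge_incmx^t* *m invmx degmx *m edge_incmx.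

Definition scatmx : 'M[C]_(m + m) :=
  \matrix_(e', e)
    (if tgt G e != src G e' then 0
     else if e' != rev e then 2 / (deg G (tgt G e))%:R
     else 2 / (deg G (tgt G e))%:R - 1).

(* Succession of oriented edges: e can be followed by e'.  Reversals e' = - e
   are counted here and removed only in nonbackmx. *)
Definition succmx : 'M[C]_(m + m) :=
  \matrix_(e', e) (tgt G e' == src G e)%:R.

Definition nonbackmx : 'M[C]_(m + m) :=
  \matrix_(e', e) ((tgt G e' == src G e) && (e != rev e'))%:R.

End GraphMatrices.

Definition psdmx (C : numClosedFieldType) n (M : 'M[C]_n) : Prop :=
  M \is hermsymmx /\ forall x : 'cV[C]_n, 0 <= (x^t* *m M *m x) 0 0.

(* Rows and columns of the 4m x 4m matrices are the pairs (oriented edge,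
   component), ordered as in the tensor product of mxtens: the pair (e, i) has
   position 2e + i. *)
Section BlockMatrices.
Variables (C : numClosedFieldType) (N : nat).

Definition BMat (M : 'I_N -> 'M[C]_2) : 'M[C]_(N * 2) :=
  \matrix_(p, q)
    let: (e', i) := mxtens_unindex p in
    let: (e, j) := mxtens_unindex q in
    if e' == e then M e i j else 0.

Definition stack (x : 'I_N -> 'cV[C]_2) : 'cV[C]_(N * 2) :=
  \col_p let: (e, i) := mxtens_unindex p in x e i 0.

(* The matrix of the system x_e' - \sum_e S_(e',e) M_e x_e, x_e in C^2. *)
Definition secmx (S : 'M[C]_N) (M : 'I_N -> 'M[C]_2) : 'M[C]_(N * 2) :=
  \matrix_(p, q)
    let: (e', i) := mxtens_unindex p in
    let: (e, j) := mxtens_unindex q in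
    ((e' == e) && (i == j))%:R - S e' e * M e i j.

End BlockMatrices.

(* Complex differentiability everywhere, when K is the complex field. *)
Definition entire (K : numFieldType) (f : K -> K) : Prop :=
  forall z : K, derivable (f : K^o -> K^o) z 1.

(* Main.v *)
(* Each of [deltatS], [deltasS] has a single 1 in every column, and reversal
   exchanges them: [deltatS *m tau = deltasS].  The factorizations are read off
   entrywise.  The rest is algebra: [incmx *m incmx^t* = 2 *: lapmx] gives
   positivity, and [deltatS *m deltat = degmx] makes the cross terms of
   [scatmx *m scatmx^t*] cancel the square of the first term. *)
Require Import Defs.
From HB Require Import structures.
From mathcomp Require Import all_boot all_order all_algebra.
From mathcomp Require Import spectral mxtens complex.
From mathcomp Require Import all_classical all_reals all_analysis.

Set Implicit Arguments.
Unset Strict Implicit.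
Unset Printing Implicit Defensive.

Import Order.TTheory GRing.Theory Num.Theory.
Import numFieldNormedType.Exports.

Local Open Scope ring_scope.
Local Open Scope complex_scope.
Local Open Scope sesquilinear_scope.

(* Unqualified, [rev] is list reversal here. *)
Local Notation rev := (@Defs.rev _).

(** * Oriented edges and their reversal *)

Section EdgeReversal.
Variables n m : nat.
Implicit Types (G : cgraph n m) (e : 'I_(m + m)).

Lemma src_lshift G i : src G (lshift m i) = etail G i.
Proof. by rewrite /src (unsplitK (inl i)). Qed.

Lemma src_rshift G i : src G (rshift m i) = ehead G i.
Proof. by rewrite /src (unsplitK (inr i)). Qed.

Lemma tgt_lshift G i : tgt G (lshift m i) = ehead G i.
Proof. by rewrite /tgt (unsplitK (inl i)). Qed.

Lemma tgt_rshift G i : tgt G (rshift m i) = etail G i.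
Proof. by rewrite /tgt (unsplitK (inr i)). Qed.

Lemma rev_lshift (i : 'I_m) : rev (lshift m i) = rshift m i.
Proof. by rewrite /rev (unsplitK (inl i)). Qed.

Lemma rev_rshift (i : 'I_m) : rev (rshift m i) = lshift m i.
Proof. by rewrite /rev (unsplitK (inr i)). Qed.

Lemma revK : involutive (@Defs.rev m).
Proof.
move=> e; case: (split_ordP e) => i ->.
  by rewrite rev_lshift rev_rshift.
by rewrite rev_rshift rev_lshift.
Qed.

Lemma eq_rev e e' : (e' == rev e) = (e == rev e').
Proof. by apply/eqP/eqP => ->; rewrite revK. Qed.

End EdgeReversal.

(** * Conjugate transposes *)

Section Adjoint.
Variable C : numClosedFieldType.

Lemma trmxCM m n p (A : 'M[C]_(m, n)) (B : 'M[C]_(n, p)) :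
  (A *m B)^t* = B^t* *m A^t*.
Proof. by rewrite trmx_mul map_mxM. Qed.

Lemma trmxCB m n (A B : 'M[C]_(m, n)) : (A - B)^t* = A^t* - B^t*.
Proof. by rewrite linearB map_mxB. Qed.

Lemma trmxCN m n (A : 'M[C]_(m, n)) : (- A)^t* = - A^t*.
Proof. by rewrite linearN map_mxN. Qed.

Lemma trmxCZn m n k (A : 'M[C]_(m, n)) : (k%:R *: A)^t* = k%:R *: A^t*.
Proof. by rewrite linearZ map_mxZ /= conjC_nat. Qed.

Lemma gram_ge0 n (y : 'cV[C]_n) : 0 <= (y^t* *m y) 0 0.
Proof.
rewrite mxE; apply: sumr_ge0 => i _.
by rewrite !mxE mulrC mul_conjC_ge0.
Qed.

End Adjoint.

(** Rows of [deltat] and [deltas] and columns of [taumx] are indicators of one index, so this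
    collapses products with them. *)
Lemma sum_eqnr (K : pzSemiRingType) (I : finType) (a : I) (F : I -> K) :
  \sum_v (v == a)%:R * F v = F a.
Proof.
rewrite (bigD1 a) //= eqxx mul1r big1 ?addr0 // => v /negbTE ->.
by rewrite mul0r.
Qed.

Section GraphFactorizations.
Variables (C : numClosedFieldType) (n m : nat) (G : cgraph n m).

Local Notation dtS := (deltatS C G).
Local Notation dsS := (deltasS C G).
Local Notation dt := (deltat C G).
Local Notation ds := (deltas C G).
Local Notation tau := (taumx C m).
Local Notation D := (degmx C G).
Local Notation A := (adjmx C G).
Local Notation L := (lapmx C G).
Local Notation S := (scatmx C G).
Local Notation B := (incmx C G).

(** * Source, target and reversal matrices *)

Lemma deltatE e v : dt e v = (v == tgt G e)%:R.
Proof. by rewrite !mxE conjC_nat. Qed.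

Lemma deltasE e v : ds e v = (v == src G e)%:R.
Proof. by rewrite !mxE conjC_nat. Qed.

Lemma trmxC_deltat : dt^t* = dtS. Proof. exact: trmxCK. Qed.

Lemma trmxC_deltas : ds^t* = dsS. Proof. exact: trmxCK. Qed.

Lemma mulmx_tau p (M : 'M[C]_(p, m + m)) i e : (M *m tau) i e = M i (rev e).
Proof.
rewrite mxE -[RHS](sum_eqnr (rev e) (M i)); apply: eq_bigr => e' _.
by rewrite mxE mulrC.
Qed.

Lemma trmxC_tau : tau^t* = tau.
Proof. by apply/matrixP => e' e; rewrite !mxE conjC_nat eq_rev. Qed.

Lemma tau_tau : tau *m tau = 1%:M.
Proof. by apply/matrixP => e' e; rewrite mulmx_tau !mxE revK. Qed.

Lemma deltatS_tau : dtS *m tau = dsS.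
Proof. by apply/matrixP => v e; rewrite mulmx_tau !mxE tgt_rev. Qed.

Lemma deltasS_tau : dsS *m tau = dtS.
Proof. by apply/matrixP => v e; rewrite mulmx_tau !mxE src_rev. Qed.

Lemma tau_deltat : tau *m dt = ds.
Proof. by rewrite -[LHS]trmxCK trmxCM trmxC_deltat trmxC_tau deltatS_tau. Qed.

Lemma tau_deltas : tau *m ds = dt.
Proof. by rewrite -[LHS]trmxCK trmxCM trmxC_deltas trmxC_tau deltasS_tau. Qed.

Lemma tau_block : tau = block_mx 0 1%:M 1%:M 0.
Proof.
apply/matrixP => e' e; case: (split_ordP e') (split_ordP e) => i -> [] j ->.
- by rewrite block_mxEul !mxE rev_lshift eq_lrshift.
- by rewrite block_mxEur !mxE rev_rshift eq_lshift.
- by rewrite block_mxEdl !mxE rev_lshift eq_rshift.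
- by rewrite block_mxEdr !mxE rev_rshift eq_rlshift.
Qed.

(** * Degrees, adjacency and the discrete Laplacian *)

Lemma degmx_tt : D = dtS *m dt.
Proof.
apply/matrixP => v w; rewrite !mxE big_split_ord /=.
under eq_bigr do rewrite deltatE !mxE tgt_lshift.
under [X in _ + X]eq_bigr do rewrite deltatE !mxE tgt_rshift.
(* On the diagonal the two halves count heads and tails at [v]; off it every term vanishes, as an
   oriented edge has only one target. *)
rewrite -big_split /=; case: eqVneq => [<-|vw].
  rewrite mulr1n /deg natr_sum; apply: eq_bigr => i _.
  by rewrite natrD addrC !(eq_sym v) -!natrM !mulnb !andbb.
have vw0 a : (v == a)%:R * (w == a)%:R = 0 :> C.
  case: (eqVneq v a) => [<-|_]; last by rewrite mul0r.
  by rewrite eq_sym (negbTE vw) mulr0.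
by rewrite mulr0n big1 // => i _; rewrite !vw0 addr0.
Qed.

Lemma degmx_ss : D = dsS *m ds.
Proof. by rewrite -tau_deltat mulmxA deltasS_tau -degmx_tt. Qed.

(** The product counts oriented edges from [w] to [v]. Each edge enters once per orientation, which
    gives the two summands of [adjnum]. *)
Lemma adjmx_ts : A = dtS *m ds.
Proof.
apply/matrixP => v w; rewrite !mxE big_split_ord /=.
under [X in X + _]eq_bigr do rewrite deltasE !mxE tgt_lshift src_lshift.
under [X in _ + X]eq_bigr do rewrite deltasE !mxE tgt_rshift src_rshift.
rewrite -big_split /= /adjnum natr_sum; apply: eq_bigr => i _.
rewrite natrD [RHS]addrC -!natrM !mulnb !(eq_sym v) !(eq_sym w).
by rewrite (andbC (_ == w)).
Qed.

Lemma adjmx_st : A = dsS *m dt.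
Proof. by rewrite -tau_deltas mulmxA deltasS_tau -adjmx_ts. Qed.

Lemma lapmx_t : L = dtS *m (dt - ds).
Proof. by rewrite mulmxBr -degmx_tt -adjmx_ts. Qed.

Lemma lapmx_s : L = (dsS - dtS) *m ds.
Proof. by rewrite mulmxBl -degmx_ss -adjmx_ts. Qed.

(** * Incidence matrix and positivity *)

Lemma incmx_diff : B = dtS - dsS.
Proof.
apply/matrixP => v e; rewrite !mxE.
(* For a loop the two indicators cancel, in agreement with the zero column of [incmx]. *)
case: (eqVneq (src G e)) => [->|st]; first by rewrite subrr.
case: (eqVneq v) => [->|_]; first by rewrite eq_sym (negbTE st) subr0.
by case: ifP => _; rewrite sub0r ?oppr0.
Qed.

Lemma trmxC_incmx : B^t* = dt - ds.
Proof. by rewrite incmx_diff trmxCB. Qed.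

Lemma incmx_tau : B *m tau = - B.
Proof. by rewrite incmx_diff mulmxBl deltatS_tau deltasS_tau opprB. Qed.

Lemma incmx_gram : B *m B^t* = 2 *: L.
Proof.
rewrite trmxC_incmx incmx_diff mulmxBl !mulmxBr -degmx_tt -adjmx_ts -adjmx_st.
by rewrite -degmx_ss -[A - D]opprB opprK scaler_nat mulr2n.
Qed.

Lemma lapmx_psd : psdmx L.
Proof.
have LE : L = 2^-1 *: (B *m B^t*).
  by rewrite incmx_gram scalerA mulVf ?scale1r // pnatr_eq0.
split.
  (* The sign in the general Hermitian condition is [(-1) ^+ 0] here. The adjoint of [dtS *m ds] is
     [dsS *m dt], which is [A] again by [adjmx_st]. *)
  apply/is_hermitianmxP; rewrite expr0 scale1r.
  rewrite /lapmx {2}degmx_tt {2}adjmx_ts trmxCB !trmxCM.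
  rewrite trmxC_deltat trmxC_deltas.
  by rewrite -degmx_tt -adjmx_st.
move=> x; rewrite LE -scalemxAr -scalemxAl mxE mulr_ge0 ?invr_ge0 ?ler0n //.
have -> : x^t* *m (B *m B^t*) *m x = (B^t* *m x)^t* *m (B^t* *m x).
  by rewrite trmxCM trmxCK !mulmxA.
exact: gram_ge0.
Qed.

(** * Normalized Laplacian and Laplacian on forms *)

Lemma normlapmx_delta :
  normlapmx C G = degmx_isqrt C G *m (dtS - dsS) *m (dt - ds) *m degmx_isqrt C G.
Proof. by rewrite /normlapmx trmxC_incmx incmx_diff !mulmxA. Qed.

Lemma normlapmx_lap :
  normlapmx C G = 2 *: (degmx_isqrt C G *m L *m degmx_isqrt C G).
Proof. by rewrite /normlapmx incmx_gram -scalemxAr -scalemxAl. Qed.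

Lemma formlapmx_delta : formlapmx C G = (dt - ds) *m invmx D *m (dtS - dsS).
Proof. by rewrite /formlapmx trmxC_incmx incmx_diff. Qed.

(** The right half holds the columns of the reversals, and reversal negates a column by
    [incmx_tau]. *)
Lemma incmx_row : B = row_mx (edge_incmx C G) (- edge_incmx C G).
Proof.
rewrite -[LHS]hsubmxK; congr row_mx; apply/matrixP => v i.
rewrite [LHS]mxE [RHS]mxE [X in _ = - X]mxE -rev_lshift -mulmx_tau incmx_tau.
by rewrite mxE.
Qed.

(** This is the reduction to size m: 1-forms are the vectors odd under reversal. Even vectors, which
    complement them, are killed by [formlapmx_even]. *)
Lemma formlapmx_odd (x : 'cV[C]_m) :
  formlapmx C G *m col_mx x (- x) =
    col_mx (2 *: (edge_formlapmx C G *m x))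
           (- (2 *: (edge_formlapmx C G *m x))).
Proof.
rewrite /formlapmx incmx_row tr_row_mx map_col_mx trmxCN.
rewrite -mulmxA mul_row_col mulNmx mulmxN opprK -mulr2n -scaler_nat.
rewrite -scalemxAr -mulmxA mul_col_mx !mulNmx scale_col_mx.
by rewrite scalerN /edge_formlapmx !mulmxA.
Qed.

Lemma formlapmx_even (x : 'cV[C]_m) : formlapmx C G *m col_mx x x = 0.
Proof.
by rewrite /formlapmx incmx_row -mulmxA mul_row_col mulNmx subrr mulmx0.
Qed.

(** * Succession and nonbacktracking *)

Lemma succmx_delta : succmx C G = dt *m dsS.
Proof.
apply/matrixP => e' e; rewrite !mxE.
under eq_bigr do rewrite deltatE mxE.
by rewrite sum_eqnr.
Qed.

Lemma succmx_nonback : succmx C G = nonbackmx C G + tau.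
Proof.
apply/matrixP => e' e; rewrite !mxE (eq_rev e).
(* A reversal always starts where its edge ends, so [succmx] has a 1 there, supplied by [tau]. *)
case: (eqVneq e) => [->|_]; last by rewrite andbT addr0.
by rewrite src_rev eqxx add0r.
Qed.

Lemma succmx_diag0 :
  (forall i : 'I_m, etail G i != ehead G i) ->
  forall e, succmx C G e e = 0.
Proof.
move=> loopless e; rewrite mxE; case: (split_ordP e) => i ->.
  by rewrite tgt_lshift src_lshift eq_sym (negbTE (loopless i)).
by rewrite tgt_rshift src_rshift (negbTE (loopless i)).
Qed.

(** * Inverse degrees and bond scattering *)

Section PositiveDegrees.
Hypothesis hdeg : forall v, (0 < deg G v)%N.

Lemma degmx_unit : D \in unitmx.
Proof.
rewrite unitmxE det_diag unitfE prodf_seq_neq0; apply/allP => v _ /=.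
by rewrite mxE pnatr_eq0 -lt0n.
Qed.

Lemma invmx_degmx : invmx D = diag_mx (\row_v (deg G v)%:R^-1).
Proof.
apply: (can_inj (mulKmx degmx_unit)); rewrite mulmxV ?degmx_unit // mulmx_diag.
apply/matrixP => v w; rewrite !mxE divff // pnatr_eq0 -lt0n; exact: hdeg.
Qed.

Lemma trmxC_invmx_degmx : (invmx D)^t* = invmx D.
Proof.
rewrite invmx_degmx tr_diag_mx map_diag_mx; congr diag_mx.
by apply/rowP => v; rewrite !mxE fmorphV /= conjC_nat.
Qed.

Lemma scatmx_delta : S = 2 *: (ds *m invmx D *m dtS) - tau.
Proof.
apply/matrixP => e' e; rewrite invmx_degmx mul_mx_diag !mxE.
under eq_bigr do rewrite mxE deltasE !mxE -mulrA.
rewrite sum_eqnr eq_sym; case: (eqVneq _ (tgt G e)) => [->|ts] /=.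
  by case: ifP => [/negbTE->|/negbFE->]; rewrite mulr1 ?subr0.
(* If the edges do not meet, [e'] cannot be [rev e], so [tau] contributes nothing. *)
rewrite mulr0 mulr0; case: eqP => [re|_]; last by rewrite subr0.
by rewrite re src_rev eqxx in ts.
Qed.

Lemma trmxC_scatmx : S^t* = 2 *: (dt *m invmx D *m dsS) - tau.
Proof.
rewrite scatmx_delta trmxCB trmxCZn !trmxCM trmxC_tau trmxC_deltas.
by rewrite trmxC_invmx_degmx mulmxA.
Qed.

Lemma scatmx_unitary : S \is unitarymx.
Proof.
apply/unitarymxP; rewrite trmxC_scatmx scatmx_delta.
rewrite mulmxBl !mulmxBr tau_tau -!scalemxAl -!scalemxAr.
rewrite -!mulmxA deltatS_tau (mulmxA tau) tau_deltat.
(* With [X = ds *m invmx D *m dsS], the product is now 4X - 2X - 2X + 1. *)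
rewrite (mulmxA dtS) -degmx_tt mulKVmx ?degmx_unit //.
by rewrite opprB addrA [2 *: (2 *: _)]scaler_nat mulr2n addrK addrC addKr.
Qed.

Lemma invmx_scatmx : invmx S = S^t*.
Proof. exact: invmx_unitary scatmx_unitary. Qed.

(** Conjugation by [tau] exchanges sources and targets in the factorization of [S], exactly as the
    adjoint does. *)
Lemma tau_scatmx_tau : tau *m S *m tau = invmx S.
Proof.
rewrite invmx_scatmx trmxC_scatmx scatmx_delta.
rewrite mulmxBr mulmxBl tau_tau mul1mx -scalemxAr -scalemxAl.
by rewrite -!mulmxA deltatS_tau (mulmxA tau) tau_deltas.
Qed.

End PositiveDegrees.
End GraphFactorizations.

(** * Tensor and block matrices of size 4m *)

Section BlockFactorizations.
Variable C : numClosedFieldType.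

Lemma sum_mxtens (K : nmodType) (N k : nat) (F : 'I_N -> 'I_k -> K) :
  \sum_p F (mxtens_unindex p).1 (mxtens_unindex p).2 = \sum_e \sum_i F e i.
Proof.
rewrite pair_big (reindex (@mxtens_index N k)); last first.
  by exists (@mxtens_unindex N k) => p _;
    rewrite (mxtens_indexK, mxtens_unindexK).
by apply: eq_bigr => -[e i] _; rewrite mxtens_indexK.
Qed.

Lemma tau_tens_block (m : nat) :
  castmx (mulnDl m m 2%N, mulnDl m m 2%N) (taumx C m *t (1%:M : 'M[C]_2)) =
    block_mx 0 1%:M 1%:M 0.
Proof.
(* The pair (e, a) sits at position 2e + a and the cast preserves positions, so the first m oriented
   edges fill exactly the first half. *)
have castl (i : 'I_m) (a : 'I_2) :
    cast_ord (esym (mulnDl m m 2%N)) (lshift _ (mxtens_index (i, a))) =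
    mxtens_index (lshift m i, a) by exact: val_inj.
have castr (i : 'I_m) (a : 'I_2) :
    cast_ord (esym (mulnDl m m 2%N)) (rshift _ (mxtens_index (i, a))) =
    mxtens_index (rshift m i, a) by apply: val_inj; rewrite /= mulnDl addnA.
apply/matrixP => p q; rewrite castmxE.
case: (split_ordP p) (split_ordP q) => p' -> [] q' ->;
  case: (mxtens_indexP p') (mxtens_indexP q') => i a [] j b;
  rewrite ?castl ?castr tensmxE tau_block.
- by rewrite !block_mxEul !mxE mul0r.
- by rewrite !block_mxEur !mxE -natrM mulnb (can_eq (@mxtens_indexK _ _)).
- by rewrite !block_mxEdl !mxE -natrM mulnb (can_eq (@mxtens_indexK _ _)).
- by rewrite !block_mxEdr !mxE mul0r.
Qed.

Lemma BMat_stack (N : nat) (M : 'I_N -> 'M[C]_2) (x : 'I_N -> 'cV[C]_2) :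
  BMat M *m stack x = stack (fun e => M e *m x e).
Proof.
apply/colP => p; case: (mxtens_indexP p) => e' i.
rewrite [LHS]mxE [RHS]mxE mxtens_indexK [RHS]mxE.
(* The summand as a function of edge and component, the shape [sum_mxtens] needs; only the block
   [e = e'] survives. *)
pose F e j := (if e' == e then M e i j else 0) * x e j 0.
rewrite (eq_bigr (fun q => F (mxtens_unindex q).1 (mxtens_unindex q).2)).
  rewrite sum_mxtens (bigD1 e') //= [X in _ + X]big1 ?addr0.
    by apply: eq_bigr => j _; rewrite /F eqxx.
  move=> e; rewrite eq_sym => /negbTE ee'; apply: big1 => j _.
  by rewrite /F ee' mul0r.
by move=> q _; rewrite !mxE mxtens_indexK; case: (mxtens_unindex q).
Qed.

Lemma secmx_factor (N : nat) (S : 'M[C]_N) (M : 'I_N -> 'M[C]_2) :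
  secmx S M = 1%:M - (S *t (1%:M : 'M[C]_2)) *m BMat M.
Proof.
apply/matrixP => p q; rewrite !mxE.
case: (mxtens_indexP p) => e' i; case: (mxtens_indexP q) => e j.
rewrite !mxtens_indexK (can_eq (@mxtens_indexK _ _)) xpair_eqE; congr (_ - _).
(* The block-diagonal factor forces [f = e] and the identity factor of the tensor product forces
   [k = i]. *)
pose F f k := S e' f * (i == k)%:R * (if f == e then M e k j else 0).
rewrite (eq_bigr (fun r => F (mxtens_unindex r).1 (mxtens_unindex r).2)).
  rewrite sum_mxtens (bigD1 e) //= [X in _ + X]big1 ?addr0.
    rewrite (bigD1 i) //= big1 ?addr0 => [|k]; first by rewrite /F !eqxx mulr1.
    by rewrite eq_sym => /negbTE ik; rewrite /F ik mulr0 mul0r.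
  move=> f /negbTE fe; apply: big1 => k _.
  by rewrite /F fe mulr0.
by move=> r _; rewrite !mxE !mxtens_indexK; case: (mxtens_unindex r).
Qed.

End BlockFactorizations.

Theorem theorem2p1 (R : realType) (n m : nat) (G : cgraph n m)
  (hdeg : forall v : 'I_n, (0 < deg G v)%N)
  (Phi : 'I_(m + m) -> R[i] -> 'M[R[i]]_2)
  (Phi_unit : forall e k, Phi e k \in unitmx)
  (Phi_entire : forall e i j, entire (fun k : R[i] => Phi e k i j)) :
  let C : numClosedFieldType := R[i] in
  let dtS := deltatS C G in
  let dsS := deltasS C G in
  let dt := deltat C G in
  let ds := deltas C G in
  let tau := taumx C m in
  let D := degmx C G in
  let Dm12 := degmx_isqrt C G in
  let A := adjmx C G in
  let L := lapmx C G in
  let S := scatmx C G in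
  (* bond-scattering matrix *)
  [/\ S = 2 *: (ds *m invmx D *m dtS) - tau,
      D = dsS *m ds, D = dtS *m dt & S \is unitarymx] /\
  (* incidence matrix *)
  (incmx C G = dtS - dsS /\ incmx C G *m tau = - incmx C G) /\
  (* adjacency matrix *)
  A = dtS *m ds /\
  (* degree matrix *)
  [/\ D = dtS *m dt, D = dsS *m ds & D = diag_mx (\row_v (deg G v)%:R)] /\
  (* discrete Laplacian *)
  [/\ L = D - A, L = dtS *m (dt - ds), L = (dsS - dtS) *m ds & psdmx L] /\
  (* normalized Laplacian *)
  (normlapmx C G = Dm12 *m (dtS - dsS) *m (dt - ds) *m Dm12 /\
   normlapmx C G = 2 *: (Dm12 *m L *m Dm12)) /\
  (* Laplacian on forms *)
  [/\ formlapmx C G = (dt - ds) *m invmx D *m (dtS - dsS),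
      forall x : 'cV[C]_m, formlapmx C G *m col_mx x (- x) =
        col_mx (2 *: (edge_formlapmx C G *m x))
               (- (2 *: (edge_formlapmx C G *m x)))
    & forall x : 'cV[C]_m, formlapmx C G *m col_mx x x = 0] /\
  (* edge reversal, 2m x 2m and 4m x 4m *)
  (tau = block_mx 0 1%:M 1%:M 0 /\
   castmx (mulnDl m m 2%N, mulnDl m m 2%N) (tau *t (1%:M : 'M[C]_2)) =
     block_mx 0 1%:M 1%:M 0) /\
  (* nonbacktracking matrix *)
  [/\ succmx C G = dt *m dsS,
      succmx C G = nonbackmx C G + tau
    & (forall i : 'I_m, etail G i != ehead G i) ->
      forall e : 'I_(m + m), succmx C G e e = 0] /\
  (* bond transfer matrix *)
  (forall (k : C) (x : 'I_(m + m) -> 'cV[C]_2),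
     BMat (fun e => Phi e k) *m stack x = stack (fun e => Phi e k *m x e)) /\
  (* secular matrix *)
  (forall k : C,
     secmx S (fun e => Phi e k) =
       1%:M - (S *t (1%:M : 'M[C]_2)) *m BMat (fun e => Phi e k)) /\
  (* facts about tau *)
  [/\ tau *m tau = 1%:M, dtS *m tau = dsS, dsS *m tau = dtS,
      tau *m S *m tau = invmx S & invmx S = S^t*].
Proof.
move=> C dtS dsS dt ds tau D Dm12 A L S.
split; first by split; [exact: scatmx_delta|exact: degmx_ss|exact: degmx_tt|
                        exact: scatmx_unitary].
split; first by split; [exact: incmx_diff|exact: incmx_tau].
split; first exact: adjmx_ts.
split; first by split; [exact: degmx_tt|exact: degmx_ss|].
split; first by split; [|exact: lapmx_t|exact: lapmx_s|exact: lapmx_psd].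
split; first by split; [exact: normlapmx_delta|exact: normlapmx_lap].
split; first by split; [exact: formlapmx_delta|exact: formlapmx_odd|
                        exact: formlapmx_even].
split; first by split; [exact: tau_block|exact: tau_tens_block].
split; first by split; [exact: succmx_delta|exact: succmx_nonback|
                        exact: succmx_diag0].
split; first by move=> k x; exact: BMat_stack.
split; first by move=> k; exact: secmx_factor.
split; [exact: tau_tau|exact: deltatS_tau|exact: deltasS_tau|
        exact: tau_scatmx_tau|exact: invmx_scatmx].
Qed.
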